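(* Let $(M_n(x,q))_{n\in\mathbb{Z}}$ be the generalized $q$-Morgan-Voyce polynomials extended to negative indices, with arbitrary initial values $M_0(x,q)$, $M_1(x,q)$. For every integer $n\ge 1$, $$M_{-n}(x,q)=C_{n}(x,q)M_{0}(x,q)+D_{n}(x,q)M_{1}(x,q),$$ where $$C_{n}(x,q)=\sum_{k=0}^{\left\lfloor \frac{n}{2}\right\rfloor}(-1)^{k}q^{\binom{n+1}{2}-k(n-k)}\binom{n-k}{k}_{q}(x+1+q)^{n-2k},$$ $$D_{n}(x,q)=\sum_{k=0}^{\left\lfloor \frac{n-1}{2}\right\rfloor}(-1)^{k+1}q^{\binom{n+1}{2}-k(n-k)}\binom{n-k-1}{k}_{q}(x+1+q)^{n-2k-1}.$$
   Context: Here $x,q$ are complex numbers with $q\neq 0,1$. The generalized $q$-Morgan-Voyce polynomials are defined, for arbitrary initial values $M_0(x,q)$, $M_1(x,q)$, by $M_{n}(x,q)=(x+1+q)M_{n-1}(x,q)-q^{n-2}M_{n-2}(x,q)$ for $n\ge 2$, and extended to negative indices by running the recurrence backwards: $M_{-n}(x,q)=q^{n}(x+1+q)M_{-n+1}(x,q)-q^{n}M_{-n+2}(x,q)$ for $n\ge 1$. The $q$-binomial coefficient is $\binom{n}{j}_q=\frac{[n]_q!}{[j]_q!\,[n-j]_q!}$ for $0\le j\le n$, with $[n]_q=1+q+\dots+q^{n-1}$, $[n]_q!=[n]_q\cdots[1]_q$, $[0]_q!=1$; it is a polynomial in $q$ (and is understood as the value of this polynomial). The exponent $\binom{n+1}{2}=n(n+1)/2$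 is an ordinary binomial coefficient. Convention: $0^0=1$. The symbol $C_n(x,q)$ here denotes only the coefficient defined in the claim. *)

(* Defs.v *)
From HB Require Import structures.
From mathcomp Require Import all_boot all_order all_algebra.
From mathcomp Require Import reals complex.

Set Implicit Arguments.
Unset Strict Implicit.
Unset Printing Implicit Defensive.

Import Order.TTheory GRing.Theory Num.Theory.
Local Open Scope ring_scope.
Local Open Scope complex_scope.

Section QBinomial.
Variable F : fieldType.

Definition qnum (n : nat) : {poly F} := \sum_(i < n) 'X^i.

Definition qfact (n : nat) : {poly F} := \prod_(i < n) qnum i.+1.

(* The quotient is taken in F[X], where it is exact, and only then evaluated,
   so that the value is the right one also when q is a root of unity. *)
Definition qbinom (n j : nat) : {poly F} :=
  if (j <= n)%N then qfact n %/ (qfact j * qfact (n - j)) else 0.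

End QBinomial.

Section QMorganVoyce.
Variables (R : realType) (M0 M1 : R[i] -> R[i] -> R[i]).

Fixpoint qMV_pos (n : nat) (x q : R[i]) : R[i] :=
  match n with
  | 0 => M0 x q
  | n1.+1 =>
    match n1 with
    | 0 => M1 x q
    | n2.+1 =>
        (x + 1 + q) * qMV_pos n1 x q - q ^+ n2 * qMV_pos n2 x q
    end
  end.

(* [qMV_neg n] has index -n. *)
Fixpoint qMV_neg (n : nat) (x q : R[i]) : R[i] :=
  match n with
  | 0 => M0 x q
  | n1.+1 =>
      q ^+ n * (x + 1 + q) * qMV_neg n1 x q
      - q ^+ n * match n1 with
                 | 0 => M1 x q
                 | n2.+1 => qMV_neg n2 x q
                 end
  end.

Definition qMV (n : int) (x q : R[i]) : R[i] :=
  match n with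
  | Posz m => qMV_pos m x q
  | Negz m => qMV_neg m.+1 x q
  end.

Lemma qMV0 x q : qMV 0 x q = M0 x q.
Proof. by []. Qed.

Lemma qMV1 x q : qMV 1 x q = M1 x q.
Proof. by []. Qed.

Lemma qMV_rec (n : nat) x q : (2 <= n)%N ->
  qMV n%:Z x q =
    (x + 1 + q) * qMV (n%:Z - 1) x q
    - q ^+ (n - 2) * qMV (n%:Z - 2) x q.
Proof.
move=> n_ge2; rewrite (@subzn n 1) ?(@subzn n 2) ?(ltnW n_ge2) //.
by case: n n_ge2 => [|[|n]] // _; rewrite !subSS !subn0.
Qed.

Lemma qMV_back (n : nat) x q : (1 <= n)%N ->
  qMV (- n%:Z) x q =
    q ^+ n * (x + 1 + q) * qMV (- n%:Z + 1) x q
    - q ^+ n * qMV (- n%:Z + 2) x q.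
Proof.
case: n => [|[|[|n]]] // _.
have -> : - n.+3%:Z + 1 = - n.+2%:Z by rewrite -[n.+3]addn1 PoszD opprD subrK.
by have -> : - n.+3%:Z + 2 = - n.+1%:Z
  by rewrite -[n.+3]addn2 PoszD opprD subrK.
Qed.

(* The natural-number subtraction in the exponents of q is not truncated:
   k <= n./2 gives k * (n - k) <= 'C(n.+1, 2). *)
Definition qMVcoefC (n : nat) (x q : R[i]) : R[i] :=
  \sum_(0 <= k < (n./2).+1)
    (-1) ^+ k * q ^+ ('C(n.+1, 2) - k * (n - k))
    * (qbinom R[i] (n - k) k).[q] * (x + 1 + q) ^+ (n - 2 * k).

Definition qMVcoefD (n : nat) (x q : R[i]) : R[i] :=
  \sum_(0 <= k < ((n - 1)./2).+1)
    (-1) ^+ k.+1 * q ^+ ('C(n.+1, 2) - k * (n - k))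
    * (qbinom R[i] (n - k - 1) k).[q] * (x + 1 + q) ^+ (n - 2 * k - 1).

End QMorganVoyce.

(* Main.v *)
Require Import Defs.
From mathcomp Require Import all_boot all_order all_algebra.
From mathcomp Require Import reals complex.
From mathcomp Require Import ring zify.
Import GRing.Theory Num.Theory.
Local Open Scope ring_scope.
Local Open Scope complex_scope.

(** Both coefficient sequences satisfy the backward recurrence of [M], and
    after comparing the powers of [q] this recurrence is, term by term, the
    q-Pascal rule [[n+1, k+1] = [n, k] + q^(k+1) [n, k+1]].  Since [- D_n] is
    the sum defining [C_(n-1)] with the exponent of [q] taken at [n] instead of
    [n-1], a single sum with a shift [a] covers both ([a = 0] and [a = 1]). *)

Section QPascal.
Variable F : fieldType.

Lemma qnumD (m n : nat) : qnum F (m + n) = qnum F m + 'X^m * qnum F n.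
Proof.
rewrite /qnum big_split_ord /= mulr_sumr; congr (_ + _).
by apply: eq_bigr => i _; rewrite exprD.
Qed.

(** The constant coefficient is 1, so evaluation at 0 decides it. *)
Lemma qnum_neq0 (n : nat) : qnum F n.+1 != 0.
Proof.
apply/eqP => /(congr1 (fun p => p.[0])); rewrite /qnum big_ord_recl hornerD.
rewrite expr0 hornerC horner_sum big1 => [|i _]; last first.
  by rewrite hornerXn expr0n.
by rewrite addr0 horner0 => /eqP; rewrite oner_eq0.
Qed.

Lemma qfact0 : qfact F 0 = 1.
Proof. by rewrite /qfact big_ord0. Qed.

Lemma qfactS (n : nat) : qfact F n.+1 = qfact F n * qnum F n.+1.
Proof. by rewrite /qfact big_ord_recr. Qed.

Lemma qfact_addS (m n : nat) :
  qfact F (m.+1 + n) = qfact F (m + n) * (qnum F m.+1 + 'X^(m.+1) * qnum F n).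
Proof. by rewrite -(qnumD m.+1) -qfactS. Qed.

Lemma qfact_neq0 (n : nat) : qfact F n != 0.
Proof. by apply/prodf_neq0 => i _; apply: qnum_neq0. Qed.

(** This makes the quotient in [qbinom] exact. In the double induction [qfact_addS] splits the
    dividend into two summands, one handled by each induction hypothesis. *)
Lemma dvdp_qfactM (j d : nat) : qfact F j * qfact F d %| qfact F (j + d).
Proof.
elim: j d => [|j IHj] d; first by rewrite qfact0 mul1r.
elim: d => [|d IHd]; first by rewrite qfact0 mulr1 addn0.
rewrite qfact_addS mulrDr; apply: dvdp_add.
  by rewrite qfactS mulrAC dvdp_mul2r ?qnum_neq0.
rewrite addnS -addSn mulrCA dvdp_mull // (qfactS d) mulrA.
by rewrite dvdp_mul2r ?qnum_neq0.
Qed.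

Lemma qbinom_fact (j d : nat) :
  qbinom F (j + d) j * (qfact F j * qfact F d) = qfact F (j + d).
Proof. by rewrite /qbinom leq_addr addKn divpK // dvdp_qfactM. Qed.

Lemma qbinom_small (n j : nat) : (n < j)%N -> qbinom F n j = 0.
Proof. by move=> lt_nj; rewrite /qbinom leqNgt lt_nj. Qed.

Lemma qbinom0 (n : nat) : qbinom F n 0 = 1.
Proof. by rewrite /qbinom leq0n qfact0 mul1r subn0 divpp ?qfact_neq0. Qed.

Lemma qbinomn (n : nat) : qbinom F n n = 1.
Proof. by rewrite /qbinom leqnn subnn qfact0 mulr1 divpp ?qfact_neq0. Qed.

Lemma qbinomS (n k : nat) :
  qbinom F n.+1 k.+1 = qbinom F n k + 'X^(k.+1) * qbinom F n k.+1.
Proof.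
case: (ltngtP n k) => [lt_nk|lt_kn|->].
- by rewrite !qbinom_small ?mulr0 ?addr0 // ltnW.
- have [d ->] : exists d, n = (k + d.+1)%N by exists (n - k).-1; lia.
  (* A common denominator of all three q-binomials: clearing it leaves an identity between
     q-factorials. *)
  have nz : qfact F k.+1 * qfact F d.+1 != 0 by rewrite mulf_neq0 ?qfact_neq0.
  apply: (mulIf nz); rewrite -addSn qbinom_fact qfact_addS.
  have e1 := qbinom_fact k d.+1; have e2 := qbinom_fact k.+1 d.
  rewrite addSnnS in e2.
  rewrite mulrDr -{1}e1 -e2 !qfactS; ring.
- by rewrite !qbinomn qbinom_small ?mulr0 ?addr0.
Qed.

End QPascal.

(** Splitting a triangle of side [k + m] leaves two triangles and a [k] by [m] rectangle. This form
    of the exponent has no truncated subtraction of products. *)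
Lemma bin2_subM (n k : nat) : (k <= n)%N ->
  ('C(n.+1, 2) - k * (n - k) = 'C(k.+1, 2) + 'C((n - k).+1, 2))%N.
Proof.
move=> le_kn; rewrite -{1}(subnKC le_kn); move: (n - k)%N => m {n le_kn}.
suff -> : 'C((k + m).+1, 2) = (k * m + ('C(k.+1, 2) + 'C(m.+1, 2)))%N.
  by rewrite addKn.
elim: k => [|k IHk] //.
by rewrite addSn binS IHk bin1 [in RHS]binS bin1; lia.
Qed.

Section Coefficients.
Variables (F : fieldType) (y q : F).

Definition MVterm (a n k : nat) : F :=
  (-1) ^+ k * q ^+ ('C((a + n).+1, 2) - k * (a + n - k))
  * (qbinom F (n - k) k).[q] * y ^+ (n - 2 * k).

Definition MVsum (a n : nat) : F := \sum_(0 <= k < n./2.+1) MVterm a n k.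

(** The vanishing q-binomial allows sums with different upper bounds to be compared over one
    range. *)
Lemma MVterm_small (a n k : nat) : (n < 2 * k)%N -> MVterm a n k = 0.
Proof.
by move=> lt_n2k; rewrite /MVterm qbinom_small ?horner0 ?mulr0 ?mul0r //; lia.
Qed.

Lemma MVsum_widen (a n N : nat) : (n./2 < N)%N ->
  MVsum a n = \sum_(0 <= k < N) MVterm a n k.
Proof.
move=> lt_nN; rewrite (@big_cat_nat _ _ _ n./2.+1) //=.
rewrite [X in _ + X]big_nat_cond [X in _ + X]big1 ?addr0 // => k.
by rewrite andbT => /andP[lt_nk _]; apply: MVterm_small; lia.
Qed.

Lemma MVterm0_rec (a n : nat) :
  MVterm a n.+1 0 = q ^+ (a + n.+1) * (y * MVterm a n 0).
Proof.
rewrite /MVterm !qbinom0 hornerC !mul0n !subn0 binS bin1 addnS.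
rewrite exprD !exprS; ring.
Qed.

Lemma MVtermS_rec (a n k : nat) :
  MVterm a n.+2 k.+1
  = q ^+ (a + n.+2) * (y * MVterm a n.+1 k.+1 - MVterm a n k).
Proof.
case: (ltnP n (2 * k)) => [lt_n2k|le_2kn].
  by rewrite !MVterm_small ?mulr0 ?subr0 ?mulr0 //; lia.
have [d ->] : exists d, n = (2 * k + d)%N by exists (n - 2 * k)%N; lia.
rewrite /MVterm !bin2_subM; try lia.
have -> : ((2 * k + d).+2 - k.+1 = (k + d).+1)%N by lia.
have -> : ((2 * k + d).+1 - k.+1 = k + d)%N by lia.
have -> : (2 * k + d - k = k + d)%N by lia.
have -> : (a + (2 * k + d).+2 - k.+1 = (a + k + d).+1)%N by lia.
have -> : (a + (2 * k + d).+1 - k.+1 = a + k + d)%N by lia.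
have -> : (a + (2 * k + d) - k = a + k + d)%N by lia.
have -> : ((2 * k + d).+2 - 2 * k.+1 = d)%N by lia.
have -> : (2 * k + d - 2 * k = d)%N by lia.
(* The two summands are the increments of the two triangular numbers in the exponent. The term from
   [n.+1] already contains the first one, so it keeps a surplus [q ^+ k.+1], the weight in
   [qbinomS]. *)
have -> : (a + (2 * k + d).+2 = k.+1 + (a + k + d).+1)%N by lia.
rewrite qbinomS hornerD hornerM hornerXn.
rewrite ['C(k.+2, 2)]binS ['C((a + k + d).+2, 2)]binS !bin1 !exprD.
rewrite [(-1) ^+ k.+1]exprS.
(* For [d = 0] the exponent of [y] at [n.+1] truncates to 0 instead of being -1, which is harmless
   because its q-binomial is 0. *)
case: d => [|d].
  by rewrite !addn0 (@qbinom_small _ k k.+1) // horner0; ring.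
have -> : ((2 * k + d.+1).+1 - 2 * k.+1 = d)%N by lia.
rewrite [y ^+ d.+1]exprS; ring.
Qed.

Lemma MVsum_rec (a n : nat) :
  MVsum a n.+2 = q ^+ (a + n.+2) * (y * MVsum a n.+1 - MVsum a n).
Proof.
(* Once [k = 0] is split off the two longer sums, all three run over [n.+2] terms and match with [k]
   shifted by one. *)
rewrite (@MVsum_widen a n.+2 n.+3) ?(@MVsum_widen a n.+1 n.+3); try lia.
rewrite (@MVsum_widen a n n.+2); last lia.
rewrite !(@big_nat_recl _ _ _ n.+2) //= MVterm0_rec.
rewrite [y * (_ + _)]mulrDr -addrA mulrDr.
congr (_ + _); rewrite mulr_sumr -sumrB mulr_sumr.
by apply: eq_bigr => k _; apply: MVtermS_rec.
Qed.

Lemma MVsum0 (a : nat) : MVsum a 0 = q ^+ 'C(a.+1, 2).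
Proof.
rewrite /MVsum big_nat1 /MVterm qbinom0 hornerC addn0 mul0n !subn0 mul1r mulr1.
by rewrite mulr1.
Qed.

Lemma MVsum1 (a : nat) : MVsum a 1 = q ^+ 'C(a.+2, 2) * y.
Proof.
rewrite /MVsum big_nat1 /MVterm qbinom0 hornerC addn1 mul0n !subn0 mul1r mulr1.
by rewrite expr1.
Qed.

End Coefficients.

Lemma qMVcoefC_MVsum (R : realType) (n : nat) (x q : R[i]) :
  qMVcoefC n x q = MVsum R[i] (x + 1 + q) q 0 n.
Proof. by []. Qed.

Lemma qMVcoefD_MVsum (R : realType) (n : nat) (x q : R[i]) :
  qMVcoefD n.+1 x q = - MVsum R[i] (x + 1 + q) q 1 n.
Proof.
rewrite /qMVcoefD /MVsum subSS subn0 -sumrN; apply: eq_bigr => k _.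
rewrite /MVterm add1n exprS.
have -> : (n.+1 - k - 1 = n - k)%N by lia.
have -> : (n.+1 - 2 * k - 1 = n - 2 * k)%N by lia.
by rewrite !mulN1r !mulNr.
Qed.

Lemma qMV_neg_coef (R : realType) (M0 M1 : R[i] -> R[i] -> R[i]) (x q : R[i])
    (n : nat) :
  qMV_neg M0 M1 n.+1 x q
  = qMVcoefC n.+1 x q * M0 x q + qMVcoefD n.+1 x q * M1 x q.
Proof.
elim/ltn_ind: n => -[|[|n]] IH.
(* Indices -1 and -2 are computed directly, since their recurrences reach back to [M1] and [M0],
   outside the induction hypothesis. *)
- rewrite qMVcoefC_MVsum qMVcoefD_MVsum MVsum1 MVsum0 /= !expr1; ring.
- rewrite qMVcoefC_MVsum qMVcoefD_MVsum MVsum_rec !MVsum1 MVsum0 /=.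
  rewrite (_ : 'C(3, 2) = 3)%N // (_ : 'C(2, 2) = 1)%N //.
  rewrite (_ : 'C(1, 2) = 0)%N //.
  ring.
have rec : qMV_neg M0 M1 n.+3 x q
    = q ^+ n.+3 * ((x + 1 + q) * qMV_neg M0 M1 n.+2 x q
                   - qMV_neg M0 M1 n.+1 x q).
  by rewrite mulrBr mulrA.
rewrite rec !IH // !qMVcoefC_MVsum !qMVcoefD_MVsum.
(* Both shifts produce the same factor [q ^+ n.+3], that of [rec]. *)
rewrite (MVsum_rec _ _ _ 0 n.+1) (MVsum_rec _ _ _ 1 n) add0n add1n; ring.
Qed.

Theorem theorem17 (R : realType) (M0 M1 : R[i] -> R[i] -> R[i]) (x q : R[i])
    (q_neq0 : q != 0) (q_neq1 : q != 1) (n : nat) (n_ge1 : (1 <= n)%N) :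
  qMV M0 M1 (- n%:Z) x q = qMVcoefC n x q * M0 x q + qMVcoefD n x q * M1 x q.
Proof. by case: n n_ge1 => // n _; apply: qMV_neg_coef. Qed.
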